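(* Let $\mathcal{E}:\mathbb{P}(2n)\to\mathbb{R}$ be defined by $$\mathcal{E}(A)=\sum_{j=1}^n\Big[(d_j(A)+1)\ln(d_j(A)+1)-(d_j(A)-1)\ln(d_j(A)-1)\Big]\quad\text{for }A\in\mathbb{G}^\circ(2n),$$ and $\mathcal{E}(A)=0$ for $A\in\mathbb{P}(2n)\setminus\mathbb{G}^\circ(2n)$. Then $\mathcal{E}$ is Fréchet differentiable on $\mathbb{G}^\circ(2n)$, and its gradient at $A\in\mathbb{G}^\circ(2n)$ is given by $$\nabla\mathcal{E}(A)=\tfrac12\,M D_{v(A)}M^\top,\qquad v(A)=\left(\ln\frac{d_1(A)+1}{d_1(A)-1},\dots,\ln\frac{d_n(A)+1}{d_n(A)-1}\right)^\top,$$ for any choice of $M\in\mathrm{SP}^\uparrow(2n,A)$.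
   Context: $n$ is a positive integer and $\mathbb{R}^n_{++}$ is the set of vectors in $\mathbb{R}^n$ with strictly positive entries. $\mathbb{S}(2n)$ is the space of real symmetric $2n\times 2n$ matrices with inner product $\langle A,B\rangle=\operatorname{Tr}(A^\top B)$ and the induced (Frobenius) norm; $\mathbb{P}(2n)\subset\mathbb{S}(2n)$ is the open subset of positive definite matrices. Gradients of real functions on $\mathbb{P}(2n)$ are elements of $\mathbb{S}(2n)$. For $x\in\mathbb{R}^n$, $D_x:=\operatorname{Diag}(x)\oplus\operatorname{Diag}(x)$. A real $2n\times 2n$ matrix $M$ is symplectic if $M^\top JM=J$ with $J=\begin{pmatrix}0&I_n\\-I_n&0\end{pmatrix}$. By Williamson's theorem, for each $A\in\mathbb{P}(2n)$ there is a unique vector $d(A)=(d_1(A),\dots,d_n(A))\in\mathbb{R}^n_{++}$ with $d_1(A)\le\cdots\le d_n(A)$ such that $M^\top AM=D_{d(A)}$ for some symplectic $M$. $\mathrm{SP}^\uparrow(2n,A)$ denotes the set of all symplectic $M$ with $M^\top AM=D_{d(A)}$. $\mathbb{G}(2n)=\{A\in\mathbb{P}(2n): d_j(A)\ge1\ \forall j\}$ is the set of covariance matrices of $n$-mode bosonic Gaussian states, and $\mathbb{G}^\circ(2n)$ is its interior, consisting of the $A\in\mathbb{P}(2n)$ with $d_j(A)>1$ for all $j$ (covariance matrices of faithful Gaussian states). $\mathcal{E}$ is the von Neumann entropy as a function of the covariance matrix. *)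

(* Defs.v *)
From HB Require Import structures.
From mathcomp Require Import all_boot all_order all_algebra.
From mathcomp Require Import all_classical all_reals all_analysis.
From mathcomp Require Import ring lra.

Set Implicit Arguments.
Unset Strict Implicit.
Unset Printing Implicit Defensive.

Import Order.TTheory GRing.Theory Num.Theory.
Import numFieldNormedType.Exports.

Local Open Scope classical_set_scope.
Local Open Scope ring_scope.

Section FrobeniusProduct.
Context {R : realType} {m : nat}.
Implicit Types A B : 'M[R]_m.

Definition frob A B : R := \tr (A^T *m B).

Lemma frobE A B : frob A B = \sum_i \sum_j A i j * B i j.
Proof.
rewrite /frob /mxtrace exchange_big /=; apply: eq_bigr => i _.
by rewrite mxE; apply: eq_bigr => j _; rewrite mxE.
Qed.

Lemma frobC A B : frob A B = frob B A.
Proof.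
by rewrite !frobE; apply: eq_bigr => i _; apply: eq_bigr => j _; rewrite mulrC.
Qed.

Lemma frobDl A B C : frob (A + B) C = frob A C + frob B C.
Proof. by rewrite /frob linearD mulmxDl mxtraceD. Qed.

Lemma frobZl a A B : frob (a *: A) B = a * frob A B.
Proof. by rewrite /frob linearZ /= -scalemxAl mxtraceZ. Qed.

Lemma frobDr A B C : frob C (A + B) = frob C A + frob C B.
Proof. by rewrite frobC frobDl !(frobC C). Qed.

Lemma frobZr a A B : frob A (a *: B) = a * frob A B.
Proof. by rewrite frobC frobZl frobC. Qed.

Lemma frob_ge0 A : 0 <= frob A A.
Proof.
by rewrite frobE; do 2 apply: sumr_ge0 => ? _; rewrite -expr2 sqr_ge0.
Qed.

Lemma frob_eq0 A : frob A A = 0 -> A = 0.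
Proof.
rewrite frobE => /eqP; rewrite psumr_eq0; last first.
  by move=> i _; apply: sumr_ge0 => j _; rewrite -expr2 sqr_ge0.
move=> /allP A0; apply/matrixP => i j; rewrite mxE.
have := A0 i (mem_index_enum i); rewrite /= psumr_eq0; last first.
  by move=> k _; rewrite -expr2 sqr_ge0.
move=> /allP /(_ j (mem_index_enum j)) /=.
by rewrite -expr2 sqrf_eq0 => /eqP.
Qed.

Definition frob_norm A : R := Num.sqrt (frob A A).

Lemma frob_norm0 A : frob_norm A = 0 -> A = 0.
Proof.
move=> /eqP; rewrite sqrtr_eq0 => A0; apply: frob_eq0.
by apply/le_anti; rewrite A0 frob_ge0.
Qed.

Lemma frob_normZ a A : frob_norm (a *: A) = `|a| * frob_norm A.
Proof.
by rewrite /frob_norm frobZl frobZr mulrA -expr2 sqrtrM ?sqr_ge0// sqrtr_sqr.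
Qed.

Lemma frob_cauchy_schwarz A B : frob A B <= frob_norm A * frob_norm B.
Proof.
have [A0|A0] := eqVneq (frob_norm A) 0.
  by rewrite A0 (frob_norm0 A0) mul0r frobE big1// => i _; rewrite big1// => j _;
    rewrite mxE mul0r.
have [B0|B0] := eqVneq (frob_norm B) 0.
  by rewrite B0 (frob_norm0 B0) mulr0 frobE big1// => i _; rewrite big1// => j _;
    rewrite mxE mulr0.
have a0 : 0 < frob_norm A by rewrite lt_def A0 sqrtr_ge0.
have b0 : 0 < frob_norm B by rewrite lt_def B0 sqrtr_ge0.
set a := frob_norm A in a0 *; set b := frob_norm B in b0 *.
have aE : frob A A = a ^+ 2 by rewrite sqr_sqrtr ?frob_ge0.
have bE : frob B B = b ^+ 2 by rewrite sqr_sqrtr ?frob_ge0.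
have := frob_ge0 (b *: A + (- a) *: B).
rewrite !(frobDl, frobDr, frobZl, frobZr) aE bE (frobC B A) => h.
have {h} : 0 <= (2 * (a * b)) * (a * b - frob A B) by move: h; lra.
by rewrite pmulr_rge0 ?subr_ge0// !mulr_gt0.
Qed.

Lemma frob_normD A B : frob_norm (A + B) <= frob_norm A + frob_norm B.
Proof.
rewrite -(@ler_pXn2r _ 2) ?nnegrE ?addr_ge0 ?sqrtr_ge0//.
rewrite sqr_sqrtr ?frob_ge0// sqrrD !sqr_sqrtr ?frob_ge0//.
rewrite !(frobDl, frobDr) (frobC B A).
have := frob_cauchy_schwarz A B; lra.
Qed.

End FrobeniusProduct.

(* The space of real symmetric m x m matrices, normed by the Frobenius norm
   (and not by the entrywise supremum norm that the library puts on matrices),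
   so that [interior], [differentiable] and ['d] below refer to this space. *)
Section SymmetricMatrices.
Context (R : realType) (m : nat).

Definition symmetric_mx : {pred 'M[R]_m} := [pred A | A^T == A].

Lemma symmetric_mx_closed : submod_closed symmetric_mx.
Proof.
split=> [|a A B]; first by rewrite inE trmx0.
by rewrite !inE linearP /= => /eqP -> /eqP ->.
Qed.

HB.instance Definition _ := GRing.isSubmodClosed.Build R 'M[R]_m
  symmetric_mx symmetric_mx_closed.

Record symM := SymM { symM_val :> 'M[R]_m ; _ : symM_val \in symmetric_mx }.

HB.instance Definition _ := [isSub for symM_val].
HB.instance Definition _ := [Choice of symM by <:].
HB.instance Definition _ := [SubChoice_isSubLmodule of symM by <:].

Let norm (A : symM) : R := frob_norm (A : 'M[R]_m).

Let ler_normD (A B : symM) : norm (A + B) <= norm A + norm B.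
Proof. exact: frob_normD. Qed.

Let normrZ (a : R) (A : symM) : norm (a *: A) = `|a| * norm A.
Proof. exact: frob_normZ. Qed.

Let normr0_eq0 (A : symM) : norm A = 0 -> A = 0.
Proof. by move=> /frob_norm0 A0; exact: val_inj. Qed.

HB.instance Definition _ :=
  Lmodule_isNormed.Build R symM ler_normD normrZ normr0_eq0.

End SymmetricMatrices.

Arguments symmetric_mx : clear implicits.

Section Gradient.
Context {R : realType} {m : nat}.
Implicit Types (f : symM R m -> R) (A H : symM R m).

Definition gradient f A : symM R m :=
  get [set G : symM R m | forall H, 'd f A H = frob G H].

(* The Riesz representation of the differential: [get] never defaults. *)
Lemma gradientP f A H : 'd f A H = frob (gradient f A) H.
Proof.
rewrite /gradient; move: H.
suff : exists G : symM R m, forall H, 'd f A H = frob G H by exact: xgetPex.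
set L : {linear symM R m -> R} := 'd f A.
pose E (i j : 'I_m) : 'M[R]_m := 2^-1 *: (delta_mx i j + delta_mx j i).
have EC i j : E i j = E j i by rewrite /E addrC.
have Esym i j : E i j \in symmetric_mx R m.
  by rewrite inE /E linearZ /= linearD /= !trmx_delta addrC.
pose e i j := SymM (Esym i j).
have Gsym : \matrix_(i, j) L (e i j) \in symmetric_mx R m.
  rewrite inE; apply/eqP/matrixP => i j; rewrite !mxE.
  by congr (L _); apply: val_inj; exact: EC.
exists (SymM Gsym) => H.
have HE : H = \sum_i \sum_j (H : 'M[R]_m) i j *: e i j.
  apply: val_inj; rewrite raddf_sum /=.
  have -> : \sum_i val (\sum_j (H : 'M[R]_m) i j *: e i j) =
            \sum_i \sum_j (H : 'M[R]_m) i j *: E i j.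
    by apply: eq_bigr => i _; rewrite raddf_sum.
  set X : 'M[R]_m := H.
  have XT : X^T = X by rewrite /X; case: (H) => H' /= /eqP.
  have -> : \sum_i \sum_j X i j *: E i j = 2^-1 *: (X + X^T).
    rewrite {2}[X]matrix_sum_delta [X^T]matrix_sum_delta.
    rewrite [in X in _ *: (_ + X)]exchange_big /= -big_split scaler_sumr /=.
    apply: eq_bigr => i _; rewrite -big_split scaler_sumr /=.
    apply: eq_bigr => j _.
    rewrite [X^T _ _]mxE /E.
    by rewrite -scalerDr scalerA mulrC -scalerA.
  rewrite XT; apply/matrixP => i j; rewrite 2!mxE; lra.
rewrite {1}HE linear_sum frobE; apply: eq_bigr => i _.
rewrite linear_sum; apply: eq_bigr => j _.
by rewrite linearZ /= mxE mulrC.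
Qed.

End Gradient.

Section GaussianStates.
Context {R : realType} {n : nat}.
Implicit Types (A : symM R (n + n)) (M : 'M[R]_(n + n)) (d x : 'rV[R]_n).

Definition posdef : set (symM R (n + n)) :=
  [set A | forall u : 'cV[R]_(n + n), u != 0 -> 0 < (u^T *m A *m u) 0 0].

Definition Dmx x : 'M[R]_(n + n) := block_mx (diag_mx x) 0 0 (diag_mx x).

Definition Jmx : 'M[R]_(n + n) := block_mx 0 1%:M (- 1%:M) 0.

Definition symplectic M := M^T *m Jmx *m M = Jmx.

Definition williamson_spectrum A d :=
  [/\ forall j, 0 < d 0 j,
      forall i j : 'I_n, (i <= j)%N -> d 0 i <= d 0 j
    & exists2 M, symplectic M & M^T *m A *m M = Dmx d].

(* d(A), as chosen by [xget]: by Williamson's theorem there is exactly one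
   candidate when A is positive definite, so the default 0 is not used there. *)
Definition symp_eig A : 'rV[R]_n := xget 0 (williamson_spectrum A).

Definition SPup A : set 'M[R]_(n + n) :=
  [set M | symplectic M /\ M^T *m A *m M = Dmx (symp_eig A)].

Definition gaussian : set (symM R (n + n)) :=
  [set A | A \in posdef /\ forall j, 1 <= symp_eig A 0 j].

(* The interior is taken in the space of symmetric matrices; as the positive
   definite matrices form an open subset of it, this is also the interior
   relative to them. *)
Definition faithful_gaussian : set (symM R (n + n)) := interior gaussian.

(* The entropy is a function on the positive definite matrices only. Here it is
   extended by 0; the values off that open set affect neither its differential
   nor its gradient at a point of it. *)
Definition entropy A : R :=
  if A \in faithful_gaussian then
    \sum_(j < n) ((symp_eig A 0 j + 1) * ln (symp_eig A 0 j + 1)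
                  - (symp_eig A 0 j - 1) * ln (symp_eig A 0 j - 1))
  else 0.

Definition log_ratio A : 'rV[R]_n :=
  \row_j ln ((symp_eig A 0 j + 1) / (symp_eig A 0 j - 1)).

End GaussianStates.

(* Main.v *)
Require Import Defs.
From HB Require Import structures.
From mathcomp Require Import all_boot all_order all_algebra.
From mathcomp Require Import all_classical all_reals all_analysis.
From mathcomp Require Import ring lra.
Import Order.TTheory GRing.Theory Num.Theory numFieldNormedType.Exports.
Local Open Scope classical_set_scope.
Local Open Scope ring_scope.

Set Implicit Arguments.
Unset Strict Implicit.
Unset Printing Implicit Defensive.

(** If [M] is symplectic and [M^T B M = D_d], then [N B := -(JB)^2] equals
    [M D_{d^2} M^-1], so that [1/2 tr p(N B)] is the sum of the [p(d_j^2)] for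
    every polynomial [p]; this is a polynomial function of [B], and its gradient
    is [M Diag(d_j p'(d_j^2)) M^T]. Choose [p] by Hermite interpolation so that
    [p(x^2)] and the entropy [f(x)] of one mode agree to first order at every
    [x = d_j(A)]. Near [A] the entropy is [1/2 tr p(N B)] plus the sum of the
    [r(d_j(B))], where [r(x) = f(x) - p(x^2)] is [o(x - d_k(A))] at each
    [d_k(A)]. By the Bauer-Fike theorem every [d_j(B)^2] is within [O(|B - A|)]
    of some [d_k(A)^2], hence the second sum is [o(|B - A|)]: no eigenvalue has
    to be followed, and multiplicities do not matter. *)

(** * Fréchet differentials as first-order estimates *)

Section DifferentialEstimates.
Context {R : realType} {V W : normedModType R}.
Implicit Types (f df : V -> W) (x : V).

Lemma is_diff_near f df x e : is_diff x f df -> 0 < e ->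
  \forall y \near x, `|f y - f x - df (y - x)| <= e * `|y - x|.
Proof.
move=> [dfx <-] e0; rewrite (near_shift 0) subr0.
have /eqaddoP/(_ e e0) := diff_locally dfx.
apply: filterS => h /=.
by rewrite addrK opprD addrA.
Qed.

Lemma near_is_diff f (df : {linear V -> W}) x : continuous df ->
  (forall e, 0 < e ->
    \forall y \near x, `|f y - f x - df (y - x)| <= e * `|y - x|) ->
  is_diff x f df.
Proof.
move=> dfc fx.
have fE : f \o shift x = cst (f x) + df +o_ 0 id.
  apply/eqaddoP => e e0; have := fx e e0; rewrite (near_shift 0) subr0.
  by apply: filterS => h /=; rewrite addrK opprD addrA.
have dE := diff_unique dfc fE.
by split=> //; apply/diff_locallyP; rewrite dE.
Qed.

Lemma is_diff_lip f df x : is_diff x f df ->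
  exists2 K, 0 < K & \forall y \near x, `|f y - f x| <= K * `|y - x|.
Proof.
move=> fx; have := is_diff_near fx ltr01.
case: (fx) => dfx <- fx1.
have /linear_boundedP : bounded_near ('d f x) (nbhs (0 : V)).
  by apply/linear_bounded_continuous/diff_continuous.
(* [K] bounds the differential; the added 1 absorbs the first-order error, taken with [e = 1]. *)
move=> /pinfty_ex_gt0 [K K0 dK]; exists (K + 1); first by rewrite addr_gt0.
apply: filterS fx1 => y yx.
rewrite -[f y - f x](subrK ('d f x (y - x))) (le_trans (ler_normD _ _))//.
by rewrite mulrDl addrC lerD.
Qed.

Lemma is_diff_sum n (f df : 'I_n -> V -> W) x :
  (forall i, is_diff x (f i) (df i)) ->
  is_diff x (fun v => \sum_i f i v) (fun h => \sum_i df i h).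
Proof.
elim: n f df => [|n IH] f df fx.
  under eq_fun do rewrite big_ord0.
  under [X in is_diff_def _ _ X]eq_fun do rewrite big_ord0.
  exact: is_diff_cst.
under eq_fun do rewrite big_ord_recl.
under [X in is_diff_def _ _ X]eq_fun do rewrite big_ord_recl.
exact: is_diffD.
Qed.

End DifferentialEstimates.

(* [horner_mx] needs a dimension of the form [k.+1], which [n + n] is not;
   in dimension 0 there is only one matrix, [X] itself. *)
Definition mxpeval (R : comNzRingType) m : 'M[R]_m -> {poly R} -> 'M[R]_m :=
  if m is k.+1 then fun X p => horner_mx X p else fun X _ => X.

Lemma mxpeval_diagonalized (K : fieldType) m (X P : 'M[K]_m) a p :
  P \in unitmx -> X *m P = P *m diag_mx a ->
  mxpeval X p *m P = P *m diag_mx (map_mx (horner p) a).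
Proof.
case: m X P a => [|k] X P a Pu XP; first by rewrite flatmx0 [RHS]flatmx0.
have -> : X = P *m diag_mx a *m invmx P by rewrite -XP mulmxK.
by rewrite /mxpeval horner_mx_uconj// mulmxKV// horner_mx_diag.
Qed.

(** * Differentials of matrix maps and of traces of polynomials *)

Section MatrixDifferential.
Context {R : realType} {V : normedModType R}.
Implicit Types x : V.

(* Entrywise, because the matrices with their supremum norm do not form a
   normed ring in the library. *)
Definition mx_is_diff x p q (F dF : V -> 'M[R]_(p, q)) :=
  forall i j, is_diff x (fun v => F v i j) (fun h => dF h i j).

Lemma mx_is_diff_cst x p q (C : 'M[R]_(p, q)) :
  mx_is_diff x (fun=> C) (fun=> 0).
Proof.
move=> i j; under [X in is_diff_def _ _ X]eq_fun do rewrite mxE.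
exact: is_diff_cst.
Qed.

Lemma mx_is_diffD x p q (F G dF dG : V -> 'M[R]_(p, q)) :
  mx_is_diff x F dF -> mx_is_diff x G dG ->
  mx_is_diff x (fun v => F v + G v) (fun h => dF h + dG h).
Proof.
move=> Fx Gx i j; under eq_fun do rewrite mxE.
under [X in is_diff_def _ _ X]eq_fun do rewrite mxE.
exact: is_diffD (Fx i j) (Gx i j).
Qed.

Lemma mx_is_diffN x p q (F dF : V -> 'M[R]_(p, q)) :
  mx_is_diff x F dF -> mx_is_diff x (fun v => - F v) (fun h => - dF h).
Proof.
move=> Fx i j; under eq_fun do rewrite mxE.
under [X in is_diff_def _ _ X]eq_fun do rewrite mxE.
exact: is_diffN (Fx i j).
Qed.

Lemma mx_is_diffM x p q r
    (F dF : V -> 'M[R]_(p, q)) (G dG : V -> 'M[R]_(q, r)) :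
  mx_is_diff x F dF -> mx_is_diff x G dG ->
  mx_is_diff x (fun v => F v *m G v) (fun h => dF h *m G x + F x *m dG h).
Proof.
move=> Fx Gx i j; under eq_fun do rewrite mxE.
apply: (@is_diff_eq _ _ _ _
    (fun h => \sum_k (F x i k * dG h k j + G x k j * dF h i k))).
  by apply: is_diff_sum => k; exact: is_diffM (Fx i k) (Gx k j).
apply/funext => h; rewrite !mxE -big_split; apply: eq_bigr => k _ /=.
by rewrite addrC [G x k j * _]mulrC.
Qed.

Lemma is_diff_mxtrace x n (F dF : V -> 'M[R]_n) :
  mx_is_diff x F dF -> is_diff x (fun v => \tr (F v)) (fun h => \tr (dF h)).
Proof. by move=> Fx; apply: is_diff_sum => i; exact: Fx. Qed.

(* Inside a trace, against a matrix commuting with [F x], the factors of the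
   Leibniz rule can be reordered as if the algebra were commutative. *)
Lemma mx_is_diff_horner x n (F dF : V -> 'M[R]_n.+1) (p : {poly R}) :
  mx_is_diff x F dF ->
  exists2 G, mx_is_diff x (fun v => horner_mx (F v) p) G &
    forall C, C *m F x = F x *m C ->
      forall h, \tr (C *m G h) = \tr (C *m horner_mx (F x) p^`() *m dF h).
Proof.
move=> Fx; elim/poly_ind: p => [|p c [G pG trG]].
  exists (fun=> 0) => [|C _ h].
    have -> : (fun v => horner_mx (F v) 0) = fun=> 0.
      by apply/funext => v; rewrite rmorph0.
    exact: mx_is_diff_cst.
  by rewrite mulmx0 deriv0 rmorph0 mulmx0 mul0mx.
exists (fun h => (G h *m F x + horner_mx (F x) p *m dF h) + 0) => [|C CF h].
  have -> : (fun v => horner_mx (F v) (p * 'X + c%:P)) =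
            fun v => horner_mx (F v) p *m F v + c%:M.
    by apply/funext=> v; rewrite rmorphD rmorphM /= horner_mx_X horner_mx_C.
  by apply: mx_is_diffD; [exact: mx_is_diffM | exact: mx_is_diff_cst].
rewrite addr0 derivMXaddC rmorphD rmorphM /= horner_mx_X.
rewrite !mulmxDr !mulmxDl !mxtraceD addrC; congr (_ + _).
  by rewrite mulmxA.
(* Cyclicity brings [F x] to the front. The induction hypothesis then applies to [F x *m C], which
   again commutes with [F x]; this is why [C] is arbitrary. *)
rewrite mulmxA mxtrace_mulC mulmxA trG; last by rewrite -mulmxA CF.
rewrite -CF -!mulmxA; congr (\tr (C *m _)); rewrite !mulmxA.
by congr (_ *m _); exact: comm_mx_horner.
Qed.

Lemma mx_is_diff_mxpeval x m (F dF : V -> 'M[R]_m) (p : {poly R}) :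
  mx_is_diff x F dF ->
  exists2 G, mx_is_diff x (fun v => mxpeval (F v) p) G &
    forall h, \tr (G h) = \tr (mxpeval (F x) p^`() *m dF h).
Proof.
case: m F dF => [|k] F dF Fx.
  by exists dF => // h; rewrite /mxtrace !big_ord0.
have [G pG trG] := mx_is_diff_horner p Fx; exists G => // h.
by rewrite -[G h]mul1mx trG ?mul1mx ?mulmx1.
Qed.

End MatrixDifferential.

(** * Hermite interpolation and perturbation of eigenvalues *)

(** Nodes are added one at a time: a multiple of [q ^+ 2], with [q] vanishing at the earlier nodes,
    changes neither values nor derivatives there. *)
Lemma hermite_interpolation (K : fieldType) (s : seq K) (a b : K -> K) :
  exists p : {poly K}, {in s, forall x, p.[x] = a x /\ p^`().[x] = b x}.
Proof.
elim: s => [|t s [p ps]]; first by exists 0.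
have [ts|ts] := boolP (t \in s).
  by exists p => x; rewrite inE => /predU1P[->|]; exact: ps.
pose q := \prod_(u <- s) ('X - u%:P).
have q0 x : x \in s -> q.[x] = 0.
  by move=> xs; apply/rootP; rewrite root_prod_XsubC.
have qt : q.[t] != 0 by rewrite -[_ == 0]/(root q t) root_prod_XsubC.
pose r al be := p + q ^+ 2 * (al%:P + be *: ('X - t%:P)).
have rE al be x : (r al be).[x] = p.[x] + q.[x] ^+ 2 * (al + be * (x - t)).
  by rewrite /r !hornerE.
have r'E al be x : (r al be)^`().[x] = p^`().[x] +
    (2%:R * q.[x] * q^`().[x] * (al + be * (x - t)) + q.[x] ^+ 2 * be).
  rewrite /r derivD derivM derivD derivC derivZ derivXsubC.
  by rewrite expr2 derivM !hornerE /=; ring.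
(* The two coefficients solve the triangular system given by the value and the derivative at [t];
   [q.[t]] is nonzero because [t] is a new node. *)
exists (r ((a t - p.[t]) / q.[t] ^+ 2)
          ((b t - p^`().[t] - 2%:R * q^`().[t] * (a t - p.[t]) / q.[t])
             / q.[t] ^+ 2)) => x.
rewrite inE => /predU1P[->|xs]; rewrite rE r'E.
  by split; field.
have [<- <-] := ps x xs; rewrite (q0 x xs).
by split; ring.
Qed.

Lemma mulmx_diag_col (R : comNzRingType) m (X P : 'M[R]_m) (a : 'rV_m) j :
  X *m P = P *m diag_mx a -> X *m col j P = a 0 j *: col j P.
Proof.
move=> XP; rewrite colE mulmxA XP -!colE; apply/matrixP => i k.
by rewrite mul_mx_diag !mxE mulrC.
Qed.

(** Write an eigenvector of [X] in the basis [Q] as [y], and let [i] be the row of its largest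
    entry. Row [i] of [E *m y] is [(a 0 j - b 0 i) * y i 0], and dividing by [y i 0] leaves at most
    the absolute row sum of [E]. *)
Lemma bauer_fike (R : realFieldType) m (X P Q : 'M[R]_m) (a b : 'rV_m) j :
  P \in unitmx -> Q \in unitmx -> X *m P = P *m diag_mx a ->
  exists i, `|a 0 j - b 0 i| <=
            \sum_k `|(invmx Q *m X *m Q - diag_mx b) i k|.
Proof.
move=> Pu Qu XP; set E := _ - diag_mx b.
pose y : 'cV_m := invmx Q *m col j P.
have Ey : E *m y = a 0 j *: y - diag_mx b *m y.
  rewrite mulmxBl /y -!mulmxA (mulmxA Q) mulmxV// mul1mx.
  by rewrite (mulmx_diag_col _ XP) -scalemxAr.
have y0 : y != 0.
  apply/eqP => /(congr1 (fun z => invmx P *m (Q *m z))).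
  rewrite mulmx0 mulmx0 /y (mulmxA Q) mulmxV// mul1mx.
  rewrite colE mulmxA mulVmx// mul1mx.
  by move=> /matrixP/(_ j 0); rewrite !mxE !eqxx => /eqP; rewrite oner_eq0.
have [i0 yi0] : exists i, y i 0 != 0.
  apply/existsP; rewrite -negb_forall; apply: contraNN y0 => /forallP y0.
  by apply/eqP/matrixP => i k; rewrite ord1 [RHS]mxE; apply/eqP.
case: (arg_maxP (fun i => `|y i 0|) (isT : xpredT i0)) => i _ ymax.
have yi : 0 < `|y i 0| by rewrite (lt_le_trans _ (ymax i0 isT))// normr_gt0.
exists i; rewrite -(ler_pM2r yi) -normrM mulr_suml.
have -> : (a 0 j - b 0 i) * y i 0 = (E *m y) i 0.
  by rewrite Ey mul_diag_mx !mxE mulrBl.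
rewrite mxE (le_trans (ler_norm_sum _ _ _))//; apply: ler_sum => k _.
by rewrite normrM ler_wpM2l ?normr_ge0//; exact: ymax.
Qed.

(** * Symplectic matrices and the diagonalization of [sqr_iJ] *)

Section Symplectic.
Context {R : realType} {n : nat}.
Implicit Types (M : 'M[R]_(n + n)) (d e : 'rV[R]_n).
Local Notation J := (@Jmx R n).

Lemma Dmx_diag d : Dmx d = diag_mx (row_mx d d).
Proof. by rewrite diag_mx_row. Qed.

Lemma tr_Dmx d : (Dmx d)^T = Dmx d.
Proof. by rewrite Dmx_diag tr_diag_mx. Qed.

Lemma Dmx_mul d e : Dmx d *m Dmx e = Dmx (\row_j (d 0 j * e 0 j)).
Proof.
rewrite /Dmx mulmx_block !(mulmx0, mul0mx, addr0, add0r) mulmx_diag.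
by congr block_mx; congr diag_mx; apply/rowP => j; rewrite !mxE.
Qed.

Lemma DmxZ c d : c *: Dmx d = Dmx (c *: d).
Proof. by rewrite /Dmx scale_block_mx !scaler0 !linearZ. Qed.

Lemma Jmx_Dmx d : J *m Dmx d = Dmx d *m J.
Proof.
rewrite /Jmx /Dmx !mulmx_block !(mulmx0, mul0mx, addr0, add0r).
by rewrite mulmxN mulNmx !(mul1mx, mulmx1).
Qed.

Lemma Jmx_sqr : J *m J = - 1%:M.
Proof.
rewrite /Jmx mulmx_block !(mulmx0, mul0mx, addr0, add0r).
by rewrite mulmxN mulmx1 mulNmx mul1mx scalar_mx_block opp_block_mx !oppr0.
Qed.

Lemma symplectic_mulVJ M : symplectic M -> (- (J *m M^T *m J)) *m M = 1%:M.
Proof.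
by move=> sM; rewrite mulNmx -!mulmxA (mulmxA _ J) sM Jmx_sqr opprK.
Qed.

Lemma symplectic_unit M : symplectic M -> M \in unitmx.
Proof. by move=> /symplectic_mulVJ /mulmx1_unit[]. Qed.

Lemma symplectic_tr M : symplectic M -> M *m J *m M^T = J.
Proof.
move=> /symplectic_mulVJ /mulmx1C; rewrite mulmxN !mulmxA => MJ.
have : - (M *m J *m M^T *m J) *m J = J by rewrite MJ mul1mx.
by rewrite mulNmx -(mulmxA _ J J) Jmx_sqr mulmxN mulmx1 opprK.
Qed.

Lemma symplectic_invJ M : symplectic M -> invmx M *m J = J *m M^T.
Proof.
by move=> sM; rewrite -{1}(symplectic_tr sM) -mulmxA mulKmx// symplectic_unit.
Qed.

Lemma symplectic_JM M (B : 'M[R]_(n + n)) d : symplectic M ->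
  M^T *m B *m M = Dmx d -> J *m B *m M = M *m J *m Dmx d.
Proof. by move=> sM <-; rewrite !mulmxA symplectic_tr. Qed.

(* [(iJB)^2]: its eigenvalues are the squares of the symplectic eigenvalues of
   [B], each with multiplicity two. *)
Definition sqr_iJ (B : 'M[R]_(n + n)) := - (J *m B *m (J *m B)).

(** In the basis [M], [J *m B] acts as [J *m Dmx d]. As [J] commutes with [Dmx d] and squares to -1,
    the sign in [sqr_iJ] cancels. *)
Lemma sqr_iJ_diagonalized M (B : 'M[R]_(n + n)) d : symplectic M ->
  M^T *m B *m M = Dmx d ->
  sqr_iJ B *m M = M *m Dmx (\row_j d 0 j ^+ 2).
Proof.
move=> sM MBM; have JM := symplectic_JM sM MBM.
rewrite /sqr_iJ mulNmx -(mulmxA (J *m B)) JM !mulmxA JM.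
have -> : M *m J *m Dmx d *m J *m Dmx d = M *m (J *m J) *m (Dmx d *m Dmx d).
  by rewrite -!mulmxA (mulmxA (Dmx d) J) -Jmx_Dmx !mulmxA.
rewrite Jmx_sqr Dmx_mul mulmxN mulmx1 mulNmx opprK; congr (M *m Dmx _).
Qed.

Lemma sqr_iJZ c B : sqr_iJ (c *: B) = c ^+ 2 *: sqr_iJ B.
Proof. by rewrite /sqr_iJ -!scalemxAr -scalemxAl scalerA scalerN. Qed.

End Symplectic.

(** * The entropy of one mode *)

Section ModeEntropy.
Context {R : realType}.
Implicit Types x y e : R.

Definition mode_entropy x : R := (x + 1) * ln (x + 1) - (x - 1) * ln (x - 1).

Lemma is_derive_xlnx x : 0 < x ->
  is_derive x 1 (fun t => t * ln t) (ln x + 1).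
Proof.
move=> x0; have lnx := is_derive1_ln x0.
apply: (@is_derive_eq _ _ _ _ _ _ _ _ (is_deriveM (is_derive_id x 1) lnx)).
by rewrite /GRing.scale /= mulfV ?gt_eqF// mulr1 addrC.
Qed.

Lemma is_derive_mode_entropy x : 1 < x ->
  is_derive x 1 mode_entropy (ln ((x + 1) / (x - 1))).
Proof.
move=> x1.
have xD : 0 < x + 1 by lra.
have xB : 0 < x - 1 by lra.
have fD : is_derive x 1 (fun t : R => t + 1) (1 + 0) by exact: is_deriveD.
have fB : is_derive x 1 (fun t : R => t - 1) (1 - 0) by exact: is_deriveB.
have eD := @is_derive1_comp _ _ (fun t => t + 1) x _ _ (is_derive_xlnx xD) fD.
have eB := @is_derive1_comp _ _ (fun t => t - 1) x _ _ (is_derive_xlnx xB) fB.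
apply: (@is_derive_eq _ _ _ _ _ _ _ _ (is_deriveB eD eB)).
rewrite ln_div ?posrE//; ring.
Qed.

Lemma is_diff_derive1 (f : R -> R) x (a : R) :
  is_derive x 1 f a -> is_diff x f (fun h => h * a).
Proof.
move=> fx; have dfx : differentiable f x by exact/derivable1_diffP/ex_derive.
split => //; rewrite diff1E// derive1E derive_val.
by apply/funext.
Qed.

Lemma mode_entropy_near (q : {poly R}) x e : 1 < x -> 0 < e ->
  q.[x] = mode_entropy x -> q^`().[x] = ln ((x + 1) / (x - 1)) ->
  \forall z \near (0 : R),
    `|mode_entropy (z + x) - q.[z + x]| <= e * `|z|.
Proof.
move=> x1 e0 qx q'x.
have fx : is_derive x 1 (mode_entropy - horner q) 0.
  apply: (@is_derive_eq _ _ _ _ _ _ _ _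
    (is_deriveB (is_derive_mode_entropy x1) (is_derive_poly q x))).
  by rewrite q'x subrr.
have := is_diff_near (is_diff_derive1 fx) e0.
rewrite (near_shift 0) subr0; apply: filterS => z /=.
rewrite mulr0 subr0 addrK.
have -> : (mode_entropy - horner q) x = 0.
  by rewrite -[LHS]/(_ - q.[x]) qx subrr.
by rewrite subr0.
Qed.

End ModeEntropy.

(** * Coordinates and gradients on symmetric matrices *)

Section SymmetricCoordinates.
Context {R : realType} {m : nat}.
Implicit Types A B H : symM R m.

Lemma symM_tr A : (A : 'M[R]_m)^T = A.
Proof. by case: A => A /= /eqP. Qed.

Lemma normr_symM_coord A i j : `|(A : 'M[R]_m) i j| <= `|A|.
Proof.
rewrite -[`|A|]/(frob_norm _) -sqrtr_sqr /frob_norm ler_sqrt ?frob_ge0//.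
rewrite frobE (bigD1 i)//= (bigD1 j)//= -expr2 -addrA lerDl.
by rewrite addr_ge0//; do !apply: sumr_ge0 => ? _; rewrite -expr2 sqr_ge0.
Qed.

Lemma mx_is_diff_symM A :
  mx_is_diff A (fun B : symM R m => B : 'M[R]_m) (fun H => H : 'M[R]_m).
Proof.
move=> i j; pose f B := (B : 'M[R]_m) i j.
have f_lin : linear f by move=> a B C; rewrite /f /= !mxE.
pose L : {linear symM R m -> R} :=
  HB.pack f (GRing.isLinear.Build _ _ _ _ f f_lin).
apply: (@near_is_diff _ _ _ f L).
  apply/linear_bounded_continuous/linear_boundedP.
  apply: filterS (nbhs_pinfty_ge (num_real 1)) => r r1 B.
  by rewrite (le_trans (normr_symM_coord B i j))// ler_peMl.
move=> e e0; apply: filterE => B.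
by rewrite -(raddfB L) subrr normr0 mulr_ge0// ltW.
Qed.

(** The difference of two representatives is symmetric and orthogonal to every symmetric matrix,
    hence to itself. *)
Lemma gradient_unique (f : symM R m -> R) A (G : 'M[R]_m) : G^T = G ->
  (forall H, 'd f A H = frob G H) -> gradient f A = G :> 'M[R]_m.
Proof.
move=> GT dfG; have Gsym : G \in symmetric_mx R m by rewrite inE GT.
pose D := gradient f A - SymM Gsym.
have fD H : frob (D : 'M[R]_m) H = 0.
  rewrite (frobDl _ (- G)) -scaleN1r frobZl -gradientP dfG; ring.
by apply/subr0_eq/frob_eq0; exact: (fD D).
Qed.

End SymmetricCoordinates.

(** * Symplectic spectra of Gaussian covariance matrices *)

Section GaussianSpectrum.
Context {R : realType} {n : nat}.
Implicit Types (A B : symM R (n + n)) (M Q : 'M[R]_(n + n)) (d e : 'rV[R]_n).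
Local Notation J := (@Jmx R n).

(* The default value 0 of [symp_eig] is excluded by [1 <= symp_eig]. *)
Lemma gaussian_williamson A : (0 < n)%N -> gaussian A ->
  williamson_spectrum A (symp_eig A).
Proof.
move=> n0 [_ A1]; have := A1 (Ordinal n0).
by rewrite /symp_eig; case: xgetP => [e -> //|_]; rewrite mxE ler10.
Qed.

Lemma row_mx_dup d (i : 'I_(n + n)) : exists k, row_mx d d 0 i = d 0 k.
Proof.
by case: (split_ordP i) => k ->; exists k; rewrite ?row_mxEl ?row_mxEr.
Qed.

Lemma bauer_fike_symplectic (X M Q : 'M[R]_(n + n)) d e j :
  M \in unitmx -> Q \in unitmx -> X *m M = M *m Dmx d ->
  exists k, exists i, `|d 0 j - e 0 k| <=
    \sum_l `|(invmx Q *m X *m Q - Dmx e) i l|.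
Proof.
rewrite !Dmx_diag => Mu Qu XM.
have [i] := bauer_fike (row_mx e e) (lshift n j) Mu Qu XM.
by have [k ->] := row_mx_dup e i; rewrite row_mxEl => dj; exists k, i.
Qed.

(** An interior point stays Gaussian when scaled by some [c < 1], and scaling multiplies the
    spectrum by [c]. An eigenvalue 1 of [A] would give the eigenvalue [c < 1] of [c *: A]. *)
Lemma faithful_gaussian_gt1 A j : faithful_gaussian A -> 1 < symp_eig A 0 j.
Proof.
move=> hA; have n0 : (0 < n)%N by apply: leq_trans (ltn_ord j).
have [c /andP[c0 c1] cA] : exists2 c : R, 0 < c < 1 & gaussian (c *: A).
  have cvA : (fun c : R => c *: A) @ (1 : R) --> A.
    rewrite -[X in _ --> X]scale1r; apply: scalel_continuous.
  have /cvA : nbhs A gaussian by exact: hA.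
  move=> /= A1; have {}A1 : \forall c \near (1 : R)^'-, gaussian (c *: A).
    by apply: cvg_at_left_filter A1; exact: cvg_id.
  near (1 : R)^'- => c; exists c; last by near: c.
  by apply/andP; split; near: c; [exact: nbhs_left_gt | exact: nbhs_left_lt].
have gA := interior_subset hA.
have [_ _ [M sM MAM]] := gaussian_williamson n0 gA.
have [_ _ [Q sQ QAQ]] := gaussian_williamson n0 cA.
have [d1 e1] := (gA.2 j, cA.2).
move: MAM QAQ d1 e1; set d := symp_eig A; set e := symp_eig _.
move=> MAM QAQ d1 e1.
have XM := sqr_iJ_diagonalized sM MAM.
have XQ : c ^+ 2 *: sqr_iJ A *m Q = Q *m Dmx (\row_k e 0 k ^+ 2).
  by rewrite -sqr_iJZ; exact: sqr_iJ_diagonalized sQ QAQ.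
have Qu := symplectic_unit sQ.
pose e' := c ^- 2 *: \row_k e 0 k ^+ 2.
(* [Q] diagonalizes [sqr_iJ A] exactly, with entries [e'], so the Bauer-Fike bound is 0 and the
   squared eigenvalues of [A] and [c *: A] match up to [c ^+ 2]. *)
have [k [i]] := bauer_fike_symplectic e' j (symplectic_unit sM) Qu XM.
rewrite big1 => [|l _]; last first.
  have -> : invmx Q *m sqr_iJ A *m Q = Dmx e'.
    rewrite -mulmxA; apply: (canLR (mulKmx Qu)).
    rewrite -DmxZ -scalemxAr -XQ -scalemxAl.
    by rewrite scalerA mulVf ?scale1r// expf_neq0// gt_eqF.
  by rewrite subrr mxE normr0.
rewrite normr_le0 subr_eq0 !mxE => /eqP de.
rewrite lt_neqAle d1 andbT eq_sym; apply/eqP => dj1.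
have ek : 1 <= e 0 k ^+ 2 by rewrite exprn_ege1.
have : c ^+ 2 * d 0 j ^+ 2 = e 0 k ^+ 2.
  by rewrite de mulrA mulfV ?mul1r// expf_neq0// gt_eqF.
rewrite dj1; nra.
Unshelve. all: by end_near. Qed.

End GaussianSpectrum.

(** * The trace polynomial and its gradient *)

Section TracePolynomial.
Context {R : realType} {n : nat}.
Implicit Types (A B H : symM R (n + n)) (M : 'M[R]_(n + n)) (d e : 'rV[R]_n).
Implicit Types (p : {poly R}).
Local Notation J := (@Jmx R n).

Lemma mxpeval_sqr_iJ (B : 'M[R]_(n + n)) M d p : symplectic M ->
  M^T *m B *m M = Dmx d ->
  mxpeval (sqr_iJ B) p *m M = M *m Dmx (\row_j p.[d 0 j ^+ 2]).
Proof.
move=> sM MBM; have := sqr_iJ_diagonalized sM MBM; rewrite Dmx_diag => XM.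
rewrite (mxpeval_diagonalized p (symplectic_unit sM) XM) map_row_mx Dmx_diag.
by congr (M *m diag_mx (row_mx _ _)); apply/rowP => j; rewrite !mxE.
Qed.

Lemma mxtrace_mxpeval_sqr_iJ (B : 'M[R]_(n + n)) M d p : symplectic M ->
  M^T *m B *m M = Dmx d ->
  \tr (mxpeval (sqr_iJ B) p) = 2 * \sum_j p.[d 0 j ^+ 2].
Proof.
move=> sM MBM; have Mu := symplectic_unit sM.
rewrite -[mxpeval _ p](mulmxK Mu) (mxpeval_sqr_iJ p sM MBM).
rewrite mxtrace_mulC mulKmx// Dmx_diag mxtrace_diag big_split_ord /=.
under eq_bigr do rewrite row_mxEl mxE.
under [X in _ + X]eq_bigr do rewrite row_mxEr mxE.
by rewrite mulr_natl mulr2n.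
Qed.

Lemma mx_is_diff_sqr_iJ A : mx_is_diff A (fun B : symM R (n + n) => sqr_iJ B)
  (fun H => - (J *m H *m (J *m A) + J *m A *m (J *m H))).
Proof.
have JA : mx_is_diff A (fun B : symM R (n + n) => J *m B) (fun H => J *m H).
  have := mx_is_diffM (mx_is_diff_cst A J) (mx_is_diff_symM A).
  by under [X in mx_is_diff _ _ X -> _]eq_fun do rewrite mul0mx add0r.
by apply: mx_is_diffN; exact: mx_is_diffM.
Qed.

(** With [P] the derived polynomial at [sqr_iJ A], the differential is half the trace of [P] times
    the differential of [sqr_iJ]. [P] commutes with [J *m A], so both Leibniz terms coincide, which
    cancels the [2^-1]. *)
Lemma is_diff_mxtrace_sqr_iJ A M d p : symplectic M ->
  M^T *m A *m M = Dmx d ->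
  is_diff A (fun B : symM R (n + n) => 2^-1 * \tr (mxpeval (sqr_iJ B) p))
    (fun H => frob (M *m Dmx (\row_j (d 0 j * p^`().[d 0 j ^+ 2])) *m M^T) H).
Proof.
move=> sM MAM; have Mu := symplectic_unit sM.
have [G pG trG] := mx_is_diff_mxpeval p (mx_is_diff_sqr_iJ A).
have := is_diffZ (2^-1) (is_diff_mxtrace pG).
move/is_diff_eq; apply; apply/funext => H /=.
rewrite [LHS]/(2^-1 * \tr (G H)) trG.
set P := mxpeval _ _; set D1 := Dmx _.
pose D' := Dmx (\row_j p^`().[d 0 j ^+ 2]).
have PM : P *m M = M *m D' by exact: mxpeval_sqr_iJ.
have JM := symplectic_JM sM MAM.
have DD' : Dmx d *m D' = D1.
  by rewrite Dmx_mul; congr Dmx; apply/rowP => j; rewrite !mxE.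
have D'D : D' *m Dmx d = D1.
  by rewrite Dmx_mul; congr Dmx; apply/rowP => j; rewrite !mxE mulrC.
pose K := M *m J *m D1 *m invmx M.
have PJ : P *m (J *m A) = K.
  apply: (canRL (mulmxK Mu)); rewrite -(mulmxA P) JM !mulmxA PM -D'D.
  by rewrite -!mulmxA; congr (M *m _); rewrite !mulmxA -Jmx_Dmx.
have JP : J *m A *m P = K.
  apply: (canRL (mulmxK Mu)).
  by rewrite -(mulmxA _ P) PM mulmxA JM -DD' !mulmxA.
(* Symplecticity replaces [invmx M *m J] by [J *m M^T]; this turns a conjugation by [M] into a
   congruence. *)
have KJ : K *m J = - (M *m D1 *m M^T).
  rewrite /K -(mulmxA _ (invmx M)) symplectic_invJ// !mulmxA.
  rewrite -(mulmxA M) Jmx_Dmx mulmxA.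
  by rewrite -(mulmxA _ J J) Jmx_sqr mulmxN mulmx1 mulNmx.
rewrite mulmxN mulmxDr [\tr (- _)]raddfN /= mxtraceD (mulmxA P (J *m A)) PJ.
rewrite (mulmxA P) [\tr (_ *m _ *m (J *m A))]mxtrace_mulC.
rewrite (mulmxA (J *m A)) JP.
rewrite !mulmxA KJ mulNmx [\tr (- _)]raddfN /= /frob.
have -> : (M *m D1 *m M^T)^T = M *m D1 *m M^T.
  by rewrite !trmx_mul trmxK tr_Dmx mulmxA.
by rewrite -[LHS]/(2^-1 * _); field.
Qed.

End TracePolynomial.

(** * The remainder is of smaller order *)

Section EntropyRemainder.
Context {R : realType} {n : nat}.
Implicit Types (A B : symM R (n + n)) (M : 'M[R]_(n + n)).

(** Bauer-Fike is applied in the fixed basis [M], where [sqr_iJ A] is diagonal: the error is a row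
    sum of [W B - W A], and [W] is differentiable at [A]. The index [k] may vary with [B]. *)
Lemma symp_eig_near A M : symplectic M -> M^T *m A *m M = Dmx (symp_eig A) ->
  exists2 K, 0 < K & \forall B \near A, gaussian B -> forall j, exists k,
    `|symp_eig B 0 j ^+ 2 - symp_eig A 0 k ^+ 2| <= K * `|B - A|.
Proof.
move=> sM MAM; have Mu := symplectic_unit sM.
pose W (B : symM R (n + n)) := invmx M *m sqr_iJ B *m M.
have WA : W A = Dmx (\row_j symp_eig A 0 j ^+ 2).
  by rewrite /W -mulmxA (sqr_iJ_diagonalized sM MAM) mulKmx.
have [dW Wdiff] : exists dW, mx_is_diff A W dW.
  eexists; exact: (mx_is_diffM (mx_is_diffM (mx_is_diff_cst A (invmx M))
    (mx_is_diff_sqr_iJ A)) (mx_is_diff_cst A M)).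
have /choice[K KP] : forall ij : 'I_(n + n) * 'I_(n + n), exists K, 0 < K /\
    \forall B \near A, `|W B ij.1 ij.2 - W A ij.1 ij.2| <= K * `|B - A|.
  by move=> ij; have [K K0 KW] := is_diff_lip (Wdiff ij.1 ij.2); exists K.
have K_ge0 ij : 0 <= K ij by exact: ltW (KP ij).1.
(* The sum over all entries dominates every row sum; the 1 makes the constant positive. *)
exists (1 + \sum_i \sum_l K (i, l)).
  by rewrite ltr_pwDl//; do 2 apply: sumr_ge0 => ? _.
have := filter_forall (nbhs_filter A) (fun ij => (KP ij).2).
apply: filterS => B BW gB j.
have n0 : (0 < n)%N by apply: leq_trans (ltn_ord j).
have [_ _ [Q sQ QBQ]] := gaussian_williamson n0 gB.
have [k [i]] := bauer_fike_symplectic (\row_l symp_eig A 0 l ^+ 2) j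
  (symplectic_unit sQ) Mu (sqr_iJ_diagonalized sQ QBQ).
rewrite !mxE => dk; exists k; apply: (le_trans dk).
rewrite -WA; apply: (@le_trans _ _ (\sum_l K (i, l) * `|B - A|)).
  by apply: ler_sum => l _; have := BW (i, l); rewrite /= !mxE.
rewrite -mulr_suml ler_wpM2r// ler_wpDl// [leRHS](bigD1 i)//= lerDl.
by do 2 apply: sumr_ge0 => ? _.
Qed.

Lemma entropy_remainder A M p : (0 < n)%N -> faithful_gaussian A ->
  symplectic M ->
  M^T *m A *m M = Dmx (symp_eig A) ->
  (forall j, p.[symp_eig A 0 j ^+ 2] = mode_entropy (symp_eig A 0 j)) ->
  (forall j, symp_eig A 0 j * p^`().[symp_eig A 0 j ^+ 2] =
             2^-1 * log_ratio A 0 j) ->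
  is_diff A (fun B : symM R (n + n) =>
    entropy B - 2^-1 * \tr (mxpeval (sqr_iJ B) p)) (fun=> 0).
Proof.
move=> n0 hA sM MAM pA p'A.
pose r x := mode_entropy x - p.[x ^+ 2].
have remE B : faithful_gaussian B ->
    entropy B - 2^-1 * \tr (mxpeval (sqr_iJ B) p) = \sum_j r (symp_eig B 0 j).
  move=> hB; rewrite /entropy mem_set//.
  have [_ _ [Q sQ QBQ]] := gaussian_williamson n0 (interior_subset hB).
  by rewrite (mxtrace_mxpeval_sqr_iJ p sQ QBQ) mulKf// -sumrB.
have remA : entropy A - 2^-1 * \tr (mxpeval (sqr_iJ A) p) = 0.
  by rewrite remE// big1// => j _; rewrite /r pA subrr.
have [K K0 AK] := symp_eig_near sM MAM.
apply: (@near_is_diff _ _ _ _ (\0 : {linear symM R (n + n) -> R})) => [|e e0].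
  exact: cst_continuous.
(* Each of the [n] modes will contribute at most [e' * (K * |B - A|)], for a total of at most
   [e * |B - A|]. *)
pose e' := e / ((1 + n%:R) * K).
have e'0 : 0 < e' by rewrite divr_gt0// mulr_gt0// ltr_pwDl.
have rA : \forall z \near (0 : R), forall j,
    `|r (z + symp_eig A 0 j)| <= e' * `|z|.
  apply: (filter_forall (nbhs_filter (0 : R))) => j.
  have A1 := faithful_gaussian_gt1 j hA.
  have := @mode_entropy_near _ (p \Po 'X^2) _ e' A1 e'0.
  rewrite deriv_comp derivXn !hornerE !horner_comp !hornerE /= => /(_ (pA j)).
  have -> : p^`().[symp_eig A 0 j ^+ 2] * (symp_eig A 0 j *+ 2) =
            ln ((symp_eig A 0 j + 1) / (symp_eig A 0 j - 1)).
    by rewrite mulrnAr mulrC p'A mxE -mulr_natl mulrA mulfV ?mul1r.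
  move=> /(_ erefl); apply: filterS => z.
  by rewrite /r horner_comp !hornerE.
have [del del0 rdel] := (nbhs_ballP _ _).1 rA.
have nearA : \forall B \near A, K * `|B - A| < del.
  have := nbhsx_ballx A _ (divr_gt0 del0 K0).
  apply: filterS => B; rewrite -ball_normE /= distrC => AB.
  by rewrite mulrC -ltr_pdivlMr.
have near_hA : \forall B \near A, faithful_gaussian B.
  exact: (open_nbhs_nbhs (conj (open_interior _) hA)).
apply: filterS3 AK nearA near_hA => B AK Bdel hB.
rewrite remA remE//= !subr0.
have rB j : `|r (symp_eig B 0 j)| <= e' * (K * `|B - A|).
  have [k dk] := AK (interior_subset hB) j.
  have dB1 := faithful_gaussian_gt1 j hB.
  have dA1 := faithful_gaussian_gt1 k hA.
  set x := symp_eig B 0 j in dk dB1 *; set y := symp_eig A 0 k in dk dA1.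
  (* Both eigenvalues exceed 1, so [x + y >= 1] and the distance of the squares bounds that of the
     eigenvalues. *)
  have xy : `|x - y| <= K * `|B - A|.
    apply: le_trans dk; rewrite subr_sqr normrM ler_peMr//.
    by rewrite ger0_norm; lra.
  have := rdel (x - y); rewrite /ball /= sub0r normrN.
  move=> /(_ (le_lt_trans xy Bdel) k).
  by rewrite -/y subrK => /le_trans; apply; rewrite ler_wpM2l// ltW.
rewrite (le_trans (ler_norm_sum _ _ _))//.
rewrite (le_trans (ler_sum _ (fun j _ => rB j)))//.
have n1_gt0 : 0 < 1 + n%:R :> R by rewrite ltr_pwDl.
rewrite sumr_const card_ord -mulr_natl.
have -> : n%:R * (e' * (K * `|B - A|)) = n%:R / (1 + n%:R) * (e * `|B - A|).
  by rewrite /e'; field; rewrite !gt_eqF.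
by rewrite ler_piMl ?mulr_ge0 ?(ltW e0)// ler_pdivrMr// mul1r lerDr.
Qed.

End EntropyRemainder.

(** * Differentiability and gradient of the entropy *)

Theorem mainTheorem6 (R : realType) (n : nat) (n_gt0 : (0 < n)%N)
    (A : symM R (n + n)) (hA : faithful_gaussian A) :
  differentiable (entropy : symM R (n + n) -> R) A /\
  forall M : 'M[R]_(n + n), SPup A M ->
    gradient entropy A = 2^-1 *: (M *m Dmx (log_ratio A) *m M^T) :> 'M[R]_(n + n).
Proof.
set d := symp_eig A.
have d1 j : 1 < d 0 j by exact: faithful_gaussian_gt1.
(* The data are the value and the derivative of [mode_entropy (Num.sqrt t)] in [t], at the squares
   of the symplectic eigenvalues. *)
have [p pP] := hermite_interpolation [seq d 0 j ^+ 2 | j <- enum 'I_n]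
  (fun t => mode_entropy (Num.sqrt t))
  (fun t => (2 * Num.sqrt t)^-1 *
            ln ((Num.sqrt t + 1) / (Num.sqrt t - 1))).
have sqrt_d j : Num.sqrt (d 0 j ^+ 2) = d 0 j.
  by rewrite sqrtr_sqr gtr0_norm// (lt_trans ltr01).
have ds j : d 0 j ^+ 2 \in [seq d 0 j ^+ 2 | j <- enum 'I_n].
  by apply/mapP; exists j; rewrite ?mem_enum.
have pd j : p.[d 0 j ^+ 2] = mode_entropy (d 0 j).
  by have [-> _] := pP _ (ds j); rewrite sqrt_d.
have p'd j : d 0 j * p^`().[d 0 j ^+ 2] = 2^-1 * log_ratio A 0 j.
  have [_ ->] := pP _ (ds j).
  rewrite sqrt_d mxE -/d mulrA invfM mulrCA mulfV ?mulr1//.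
  by rewrite gt_eqF// (lt_trans ltr01).
have diffE M : symplectic M -> M^T *m A *m M = Dmx d ->
    is_diff A (entropy : symM R (n + n) -> R)
      (fun H => frob (2^-1 *: (M *m Dmx (log_ratio A) *m M^T)) H).
  move=> sM MAM.
  have rdiff := entropy_remainder n_gt0 hA sM MAM pd p'd.
  have := is_diffD rdiff (is_diff_mxtrace_sqr_iJ p sM MAM).
  have -> : (fun B : symM R (n + n) =>
      entropy B - 2^-1 * \tr (mxpeval (sqr_iJ B) p)) +
      (fun B : symM R (n + n) => 2^-1 * \tr (mxpeval (sqr_iJ B) p)) = entropy.
    by apply/funext => B; exact: subrK.
  have -> : \row_j (d 0 j * p^`().[d 0 j ^+ 2]) = 2^-1 *: log_ratio A.
    by apply/rowP => j; rewrite !mxE p'd mxE.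
  rewrite scalemxAl scalemxAr DmxZ.
  by move/is_diff_eq; apply; apply/funext => H; exact: add0r.
have gA := interior_subset hA.
split=> [|M [sM MAM]].
  (* Differentiability needs one diagonalizing [M] to exist; the gradient formula is then read off
     for any given one. *)
  have [_ _ [M sM MAM]] := gaussian_williamson n_gt0 gA.
  exact: (@ex_diff _ _ _ _ _ _ _ (diffE M sM MAM)).
apply: gradient_unique.
  by rewrite linearZ /= !trmx_mul trmxK tr_Dmx mulmxA.
by move=> H; rewrite (@diff_val _ _ _ _ _ _ _ (diffE M sM MAM)).
Qed.
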